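(* Let $r\geq 3$ and let $\Gamma$ be an $r$-uniform supertree with $w\in V(\Gamma)$. Let $u$ be a pendent vertex (a vertex of degree $1$) of the pendent edge of $\mathcal{R}(1,1,2,4)$ attached at $v_3$, and let $v$ be a pendent vertex of the pendent edge of $\mathcal{R}(1,3,1,3)$ attached at $v_6$. Then $\rho(\mathcal{R}(1,1,2,4)_u\cdot\Gamma_w)=\rho(\mathcal{R}(1,3,1,3)_v\cdot\Gamma_w)$ and $ME(\mathcal{R}(1,1,2,4)_u\cdot\Gamma_w)=ME(\mathcal{R}(1,3,1,3)_v\cdot\Gamma_w)$.
   Context: An $r$-uniform supertree is a connected acyclic hypergraph each of whose edges has exactly $r$ vertices. The loose path $\mathcal{P}^r_t=v_1e_1v_2\cdots v_te_tv_{t+1}$ of length $t$ has edges $e_i=\{v_i,u_{i,1},\dots,u_{i,r-2},v_{i+1}\}$ with all listed vertices distinct. For positive integers $a,b,c,d$, $\mathcal{R}(a,b,c,d)$ is obtained from $\mathcal{P}^r_{a+b+c+d}$ by attaching one pendent edge (an edge containing one existing vertex and $r-1$ new vertices) at each of the vertices $v_{a+1}$, $v_{a+b+1}$ and $v_{a+b+c+1}$. $\mathcal{R}_u\cdot\Gamma_w$ denotes the hypergraph obtained from disjoint $\mathcal{R}$ and $\Gamma$ by identifying $u$ with $w$. For an $r$-uniform hypergraph $\mathcal{H}$ on $n$ vertices, $m(\mathcal{H},k)$ is the number of sets of $k$ pairwise disjoint edges ($m(\mathcal{H},0)=1$), $\varphi(\mathcal{H},x)=\sum_{k\geq0}(-1)^km(\mathcal{H},k)x^{n-kr}$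 is its matching polynomial, and $ME(\mathcal{H})$ is the sum of absolute values of all roots (with multiplicity) of $\varphi(\mathcal{H},x)$. The adjacency tensor has entries $a_{i_1\cdots i_r}=1/(r-1)!$ if $\{i_1,\dots,i_r\}$ is an edge and $0$ otherwise; $\lambda$ is an eigenvalue if some nonzero $x\in\mathbb{C}^n$ satisfies $\sum_{i_2,\dots,i_r}a_{ii_2\cdots i_r}x_{i_2}\cdots x_{i_r}=\lambda x_i^{r-1}$ for all $i$; $\rho(\mathcal{H})$ is the maximum modulus of the eigenvalues. *)

(* Defs.v *)
From HB Require Import structures.
From mathcomp Require Import all_boot all_order all_algebra.
From mathcomp Require Import complex.
From mathcomp Require Import classical_sets reals.
Set Implicit Arguments.
Unset Strict Implicit.
Unset Printing Implicit Defensive.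
Import Order.TTheory GRing.Theory Num.Theory.
Local Open Scope ring_scope.

Section Hypergraph.
Variable V : finType.
Implicit Types (E : {set {set V}}).

Definition uniform (r : nat) E := forall e, e \in E -> #|e| = r.

Definition hadj E : rel V := fun x y => [exists e in E, (x \in e) && (y \in e)].

Definition hconnected E := forall x y : V, connect (hadj E) x y.

Definition berge_cycle E (k : nat) (vs : 'I_k.+2 -> V) (es : 'I_k.+2 -> {set V}) :=
  [/\ injective vs, injective es,
      forall i, es i \in E &
      forall i, (vs i \in es i) && (vs (ordS i) \in es i)].

Definition acyclic E := forall k vs es, ~ @berge_cycle E k vs es.

Definition supertree (r : nat) E := [/\ uniform r E, hconnected E & acyclic E].

Definition hdeg E (v : V) : nat := #|[set e in E | v \in e]|.

Definition is_matching E (M : {set {set V}}) :=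
  (M \subset E) &&
  [forall e1 in M, forall e2 in M, (e1 != e2) ==> [disjoint e1 & e2]].

Definition nmatch E (k : nat) : nat := #|[set M | is_matching E M & #|M| == k]|.

End Hypergraph.

Section Spectral.
Variable R : realType.
Local Notation C := R[i].
Variable V : finType.
Variable r : nat.
Variable E : {set {set V}}.

Definition adj_entry (s : seq V) : C :=
  if [set j | j \in s] \in E then (r.-1)`!%:R^-1 else 0.

Definition tensor_eigenvalue (l : C) :=
  exists x : V -> C, (exists i, x i != 0) /\
    forall i : V,
      \sum_(t : (r.-1).-tuple V) adj_entry (i :: t) * \prod_(j <- t) x j
      = l * x i ^+ r.-1.

Definition spectral_radius : R :=
  sup [set ComplexField.Normc.normc l | l in tensor_eigenvalue].

Definition matching_poly : {poly C} :=
  \sum_(k < (#|V| %/ r).+1)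
     ((-1) ^+ k * (nmatch E k)%:R) *: 'X^(#|V| - k * r).

(* the roots of the matching polynomial, with multiplicity:
   matching_poly = lead_coef matching_poly *: \prod_(z <- roots) ('X - z) *)
Definition matching_roots : seq C := sval (closed_field_poly_normal matching_poly).

Definition matching_energy : R := \sum_(z <- matching_roots) ComplexField.Normc.normc z.

End Spectral.

(* Vertices: path vertices v_1..v_{t+1} (index 0..t), inner vertices    *)
(* u_{i,j} of the path edges, and the r-1 new vertices of each of the   *)
(* three pendent edges.                                                 *)

Section RGraph.
Variables (r a b c d : nat).
Definition tlen := (a + b + c + d)%N.

Definition Rvert : finType :=
  ('I_tlen.+1 + ('I_tlen * 'I_(r - 2)) + ('I_3 * 'I_(r - 1)))%type.

Definition pathv (i : nat) : Rvert := inl (inl (inord i)).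

(* e_{i+1} = {v_{i+1}, u_{i+1,1}, ..., u_{i+1,r-2}, v_{i+2}}, i : 'I_t *)
Definition path_edge (i : 'I_tlen) : {set Rvert} :=
  [set pathv i; pathv i.+1] :|: [set (inl (inr (i, j)) : Rvert) | j : 'I_(r - 2)].

(* 0-based index of the attachment vertex v_{a+1}, v_{a+b+1}, v_{a+b+c+1} *)
Definition attach_pos (k : 'I_3) : nat := nth 0%N [:: a; a + b; a + b + c]%N k.

Definition pend_edge (k : 'I_3) : {set Rvert} :=
  pathv (attach_pos k) |: [set (inr (k, j) : Rvert) | j : 'I_(r - 1)].

Definition Redges : {set {set Rvert}} :=
  [set path_edge i | i : 'I_tlen] :|: [set pend_edge k | k : 'I_3].

End RGraph.

(* Coalescence H1_u . H2_w: identify u in H1 with w in H2.             *)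

Section Coalescence.
Variables (V1 V2 : finType) (u : V1) (w : V2).
Definition coal_vert : finType := (V1 + {x : V2 | x != w})%type.

Definition coal_map2 (x : V2) : coal_vert :=
  if insub x is Some y then inr y else inl u.

Definition coal_edges (E1 : {set {set V1}}) (E2 : {set {set V2}})
  : {set {set coal_vert}} :=
  [set [set (inl x : coal_vert) | x in e] | e : {set V1} in E1] :|:
  [set [set coal_map2 x | x in e] | e : {set V2} in E2].
End Coalescence.

(* Main.v *)
Require Import Defs.
From HB Require Import structures.
From mathcomp Require Import all_boot all_order all_algebra.
From mathcomp Require Import complex polyrcf.
From mathcomp Require Import classical_sets reals.
From mathcomp Require Import ring zify.
Import mathcomp.boot.fintype mathcomp.boot.finset.
Set Implicit Arguments.
Unset Strict Implicit.
Unset Printing Implicit Defensive.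
Import Order.TTheory GRing.Theory Num.Theory.
Local Open Scope ring_scope.

(** Let [M_H(y) = \sum_k (-1)^k m(H,k) y^k], the independence polynomial at [-y] of
    the line graph of [H].  It determines the matching polynomial, hence the
    matching energy.  For a supertree [H] with an edge it also determines the
    spectral radius: if [b] is the least positive root of [M_H], then the values
    [M_(H-v)(b)] are positive, and their [r]-th roots form an eigenvector for
    the eigenvalue [b^(-1/r)], because for every edge [e]
      [\prod_(v in e) M_(H-v) = M_(H-V(e)) * M_(H\e)^(r-1)]
    and [M_H = M_(H-v) - y * \sum_(e contains v) M_(H-V(e))].  A positive
    eigenvector bounds all eigenvalues, so the spectral radius is [b^(-1/r)].

    It remains to compare [M] for the two coalescences.  Expanding along the
    pendent edge [p] that carries the identified vertex leaves only
    [M_(R\p)] and [M_(R-V(p))], besides polynomials of the other tree, and for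
    the two hypergraphs [R] these come from isomorphic line graphs. *)

(** * Independence polynomials and their recurrences *)

Section IndependencePolynomial.
Variables (R : comNzRingType) (T : finType) (ok : rel T).
Hypothesis ok_sym : symmetric ok.
Implicit Types S A B : {set T}.

(** [ok] is compatibility, the complement of adjacency. The guard makes its diagonal irrelevant, so
    that [disj] can serve although a nonempty edge is not disjoint from itself. *)
Definition indep A := [forall x in A, forall y in A, (x != y) ==> ok x y].

Definition indpoly S : {poly R} :=
  \sum_(A : {set T} | (A \subset S) && indep A) (- 'X) ^+ #|A|.

(** For [v] in [S], this is [S] without the closed neighbourhood of [v]. *)
Definition avoid S v := [set x in S | (x != v) && ok v x].

Lemma indepP A :
  reflect {in A &, forall x y, x != y -> ok x y} (indep A).
Proof.
apply: (iffP forall_inP) => [H x y xA yA | H x xA].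
  by move: (forall_inP (H x xA) y yA) => /implyP.
by apply/forall_inP=> y yA; apply/implyP; apply: H.
Qed.

Lemma indpoly0 : indpoly set0 = 1.
Proof.
rewrite /indpoly (bigD1 set0) /=; last first.
  by rewrite sub0set; apply/indepP => x; rewrite inE.
rewrite cards0 expr0 big1 ?addr0 // => A /andP[/andP[sA _]].
by rewrite -subset0 sA.
Qed.

Lemma indep_setU1 A v :
  v \notin A -> indep (v |: A) = indep A && [forall x in A, ok v x].
Proof.
move=> vA; apply/indepP/andP => [H|[/indepP HA /forall_inP Hv] x y].
  split; first by apply/indepP => x y xA yA; apply: H; rewrite !inE ?xA ?yA orbT.
  apply/forall_inP => x xA; apply: H; rewrite ?in_setU1 ?eqxx ?xA ?orbT //.
  by apply: contraNneq vA => ->.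
rewrite !inE => /orP[/eqP->|xA] /orP[/eqP->|yA]; rewrite ?eqxx // => xy.
- exact: Hv.
- by rewrite ok_sym Hv.
- exact: HA.
Qed.

(** Independent sets without [v] give the first term. Those with [v] are [v |: A] with [A]
    independent in [avoid S v], and the extra vertex costs a factor [- 'X]. *)
Lemma indpoly_rec S v : v \in S ->
  indpoly S = indpoly (S :\ v) - 'X * indpoly (avoid S v).
Proof.
move=> vS; rewrite /indpoly (bigID (fun A => v \in A)) /= addrC; congr (_ + _).
  by apply: eq_bigl => A; rewrite subsetD1 -!andbA; do 2 bool_congr.
rewrite -mulNr mulr_sumr.
rewrite (reindex_onto (fun A => v |: A) (fun A => A :\ v)) /=; last first.
  by move=> A /andP[_ vA]; rewrite setD1K.
(* The condition [(v |: A) :\ v == A] left by the reindexing says that [v \notin A]. *)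
have E A : [&& v |: A \subset S, indep (v |: A), v \in v |: A & (v |: A) :\ v == A]
    = (A \subset avoid S v) && indep A.
  have [vA|vA] := boolP (v \in A).
    rewrite [in RHS](negPf (_ : ~~ (A \subset _))); last first.
      by apply/negP => /subsetP /(_ v vA); rewrite !inE eqxx andbF.
    by rewrite (negPf (_ : _ != A)) ?andbF //; apply: contraTneq vA => <-; rewrite !inE eqxx.
  rewrite setU1K // eqxx setU11 !andbT indep_setU1 // subUset sub1set vS /=.
  rewrite [indep A && _]andbC andbA; congr (_ && _).
  apply/andP/subsetP => [[/subsetP AS /forall_inP H] x xA|H].
    by rewrite !inE AS //= H // andbT; apply: contraNneq vA => <-.
  split; first by apply/subsetP => x /H; rewrite inE => /andP[].
  by apply/forall_inP => x /H; rewrite !inE => /and3P[].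
apply: eq_big => [A|A]; first by rewrite -andbA -andbA E.
rewrite -andbA -andbA E => /andP[/subsetP sA _].
rewrite cardsU1 (_ : v \notin A) ?exprS //.
by apply/negP => /sA; rewrite !inE eqxx andbF.
Qed.

Lemma subset_avoid S v : avoid S v \subset S.
Proof. by apply/subsetP => x; rewrite inE => /andP[]. Qed.

Lemma card_avoid S v : v \in S -> (#|avoid S v| < #|S|)%N.
Proof.
move=> vS; apply: proper_card; apply/properP; split; first exact: subset_avoid.
by exists v => //; rewrite !inE eqxx andbF.
Qed.

(** Induction on [S1]: for [v] in [S1] the recurrence changes only the part in [S1], because [v] is
    compatible with all of [S2]. *)
Lemma indpolyM S1 S2 : [disjoint S1 & S2] ->
  {in S1 & S2, forall x y, ok x y} ->
  indpoly (S1 :|: S2) = indpoly S1 * indpoly S2.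
Proof.
have [n] := ubnP #|S1|; elim: n S1 => // n IH S1 lt12 dis H.
have [->|[v vS1]] := set_0Vmem S1; first by rewrite set0U indpoly0 mul1r.
have vS2 : v \notin S2 by rewrite (disjointFr dis).
rewrite (indpoly_rec vS1) (@indpoly_rec _ v) ?inE ?vS1 //.
have -> : (S1 :|: S2) :\ v = (S1 :\ v) :|: S2.
  by apply/setP => x; rewrite !inE; case: eqVneq => [->|] //=; rewrite (negPf vS2).
have -> : avoid (S1 :|: S2) v = avoid S1 v :|: S2.
  apply/setP => x; rewrite !inE; have [xS2|] := boolP (x \in S2); last by rewrite !orbF.
  by rewrite !orbT /= H // andbT; apply: contraNneq vS2 => <-.
rewrite !IH; first by rewrite mulrBl mulrA.
- exact: leq_trans (card_avoid vS1) lt12.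
- exact: disjointWl (subset_avoid _ _) dis.
- by move=> x y /(subsetP (subset_avoid _ _)); apply: H.
- exact: leq_trans (proper_card (properD1 vS1)) lt12.
- by apply: disjointWl dis; rewrite subD1set.
- by move=> x y; rewrite inE => /andP[_]; apply: H.
Qed.

(** Classes are split off one at a time by [indpolyM]. [K] may exceed the image of [c], since an
    empty class contributes the factor 1. *)
Lemma indpoly_classes (I : finType) (c : T -> I) S (K : {set I}) :
  {in S &, forall x y, c x != c y -> ok x y} ->
  {in S, forall x, c x \in K} ->
  indpoly S = \prod_(k in K) indpoly [set x in S | c x == k].
Proof.
move=> H; have [n] := ubnP #|K|; elim: n K S H => // n IH K S H ltn cK.
have [K0|[k kK]] := set_0Vmem K.
  rewrite K0 big_set0; suff -> : S = set0 by rewrite indpoly0.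
  by apply/setP => x; rewrite inE; apply/negP => /cK; rewrite K0 inE.
have ES : S = [set x in S | c x == k] :|: [set x in S | c x != k].
  by apply/setP => x; rewrite !inE -andb_orr orbN andbT.
have D : [disjoint [set x in S | c x == k] & [set x in S | c x != k]].
  rewrite -setI_eq0; apply/eqP/setP => x; rewrite !inE.
  by case: (c x == k); rewrite ?andbF.
rewrite {1}ES (indpolyM D); last first.
  move=> x y; rewrite !inE => /andP[xS /eqP cx] /andP[yS cy].
  by apply: H => //; rewrite cx eq_sym.
rewrite (bigD1 k) //=; congr (_ * _).
rewrite (IH (K :\ k)).
- apply: eq_big => [j|j]; first by rewrite in_setD1 andbC.
  rewrite in_setD1 => /andP[jk _]; congr indpoly; apply/setP => x; rewrite !inE.
  by case: (eqVneq (c x) j) => [->|]; rewrite ?andbF // jk andbT.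
- by move=> x y; rewrite !inE => /andP[xS _] /andP[yS _]; apply: H.
- exact: leq_trans (proper_card (properD1 kK)) ltn.
- by move=> x; rewrite !inE => /andP[/cK -> ->].
Qed.

End IndependencePolynomial.

(** The recurrences at [v] and at [f v] unfold in parallel. *)
Lemma indpoly_imset (R : comNzRingType) (T1 T2 : finType) (ok1 : rel T1) (ok2 : rel T2)
    (f : T1 -> T2) (S : {set T1}) :
  symmetric ok1 -> symmetric ok2 -> {in S &, injective f} ->
  {in S &, forall x y, ok2 (f x) (f y) = ok1 x y} ->
  indpoly R ok2 (f @: S) = indpoly R ok1 S.
Proof.
move=> sym1 sym2; have [n] := ubnP #|S|; elim: n S => // n IH S ltn fI H.
have [->|[v vS]] := set_0Vmem S; first by rewrite imset0 !indpoly0.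
rewrite (indpoly_rec _ sym1 vS) (indpoly_rec _ sym2 (imset_f f vS)).
have -> : f @: S :\ f v = f @: (S :\ v).
  apply/setP => y; rewrite !inE; apply/andP/imsetP => [[yv /imsetP[x xS yE]]|[x]].
    by exists x => //; rewrite !inE xS andbT; apply: contraNneq yv => <-; apply/eqP.
  rewrite !inE => /andP[xv xS] ->; split; last exact: imset_f.
  by apply: contraNneq xv => /fI ->.
have -> : avoid ok2 (f @: S) (f v) = f @: avoid ok1 S v.
  apply/setP => y; rewrite !inE; apply/and3P/imsetP => [[/imsetP[x xS ->] yv okx]|[x]].
    exists x => //; rewrite !inE xS -H // okx andbT.
    by apply: contraNneq yv => ->.
  rewrite !inE => /and3P[xS xv okx] ->; rewrite imset_f // H // okx; split=> //.
  by apply: contraNneq xv => /fI ->.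
have sD : S :\ v \subset S by rewrite subD1set.
have sA := subset_avoid ok1 S v.
rewrite !IH //.
- exact: leq_trans (card_avoid _ vS) ltn.
- by move=> x y /(subsetP sA) xS /(subsetP sA); apply: fI.
- by move=> x y /(subsetP sA) xS /(subsetP sA); apply: H.
- exact: leq_trans (proper_card (properD1 vS)) ltn.
- by move=> x y /(subsetP sD) xS /(subsetP sD); apply: fI.
- by move=> x y /(subsetP sD) xS /(subsetP sD); apply: H.
Qed.

(** * Least positive roots of independence polynomials *)

Section FirstRoot.
Variable R : rcfType.

(** When [0 < p.[0]] this is the least positive root. Stating positivity on the whole of [[0, b)]
    records the sign that the later comparisons use. *)
Definition first_root (p : {poly R}) (b : R) :=
  [/\ 0 < b, p.[b] = 0 & forall t, 0 <= t < b -> 0 < p.[t]].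

Lemma first_root_uniq p b1 b2 : first_root p b1 -> first_root p b2 -> b1 = b2.
Proof.
move=> [b1_gt0 r1 H1] [b2_gt0 r2 H2]; apply/eqP; case: ltgtP => // lt12.
  by move: (H2 b1); rewrite r1 ltxx ltW // lt12 => /(_ isT).
by move: (H1 b2); rewrite r2 ltxx ltW // lt12 => /(_ isT).
Qed.

Lemma horner_gt0_before (p : {poly R}) b : 0 < p.[0] ->
  (forall t, 0 < t < b -> ~~ root p t) -> forall t, 0 <= t < b -> 0 < p.[t].
Proof.
move=> p0 H t /andP[t0 tb]; rewrite ltNge; apply/negP => pt.
have [|c + rc] := @polyrcf.poly_ivt R p 0 t t0; first by rewrite pmulr_rle0.
rewrite in_itv /= => /andP[c0 ct].
apply: (negP (H c _)) => //; rewrite (le_lt_trans ct tb) andbT lt_neqAle c0 andbT.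
by apply: contraTneq rc => <-; rewrite rootE gt_eqF.
Qed.

(** The intermediate value theorem gives some root in [(0, b]], and the least positive root is at
    most that one. *)
Lemma first_root_exists (p : {poly R}) b : 0 < p.[0] -> 0 < b -> p.[b] <= 0 ->
  exists2 c, first_root p c & c <= b.
Proof.
move=> p0 b0 pb.
have pn0 : p != 0 by apply: contraTneq p0 => ->; rewrite horner0 ltxx.
have [|c0 + rc0] := @polyrcf.poly_ivt R p 0 b (ltW b0); first by rewrite pmulr_rle0.
rewrite in_itv /= => /andP[c0_ge0 c0b].
have c0_gt0 : 0 < c0.
  rewrite lt_neqAle c0_ge0 andbT; apply: contraTneq rc0 => <-.
  by rewrite rootE gt_eqF.
case: (@next_rootP R p 0 c0) => [p_eq0|y _ py yI hy|c _ _ hc].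
- by rewrite p_eq0 eqxx in pn0.
- exists y; last by rewrite (le_trans _ c0b) // ltW // (itvP yI).
  split; rewrite ?(itvP yI) //; exact: horner_gt0_before.
exists c0 => //; split => //; first exact/rootP.
exact: horner_gt0_before.
Qed.

Variables (T : finType) (ok : rel T).
Hypothesis ok_sym : symmetric ok.
Implicit Types S A B : {set T}.
Local Notation I S := (indpoly R ok S).

Lemma indpoly_horner0 S : (I S).[0] = 1.
Proof.
have [n] := ubnP #|S|; elim: n S => // n IH S ltn.
have [->|[v vS]] := set_0Vmem S; first by rewrite indpoly0 hornerC.
rewrite (indpoly_rec _ ok_sym vS) !hornerE IH ?subr0 //.
exact: leq_trans (proper_card (properD1 vS)) ltn.
Qed.

(* At the first root [b'] of [I (S :\ v)] the recurrence gives
   [(I S).[b'] = - b' * (I (avoid ok S v)).[b'] <= 0] by induction, so the first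
   root of [I S] is at most [b']. *)
Lemma indpoly_first_root S : S != set0 -> exists2 b, first_root (I S) b &
  forall A, A \subset S -> forall t, 0 <= t < b -> 0 < (I A).[t].
Proof.
have [n] := ubnP #|S|; elim: n S => // n IH S ltn S0.
have step v : v \in S -> exists b, [/\ 0 < b, (I S).[b] <= 0 &
    forall A, A \subset S :\ v -> forall t, 0 <= t < b -> 0 < (I A).[t]].
  move=> vS; have ltD := leq_trans (proper_card (properD1 vS)) ltn.
  have [D0|D0] := eqVneq (S :\ v) set0.
    (* Here [S] is the single vertex [v], with polynomial [1 - 'X]. *)
    exists 1; split => //; last first.
      by move=> A; rewrite D0 subset0 => /eqP -> t _; rewrite indpoly0 hornerC.
    have AD : avoid ok S v \subset S :\ v.
      by apply/subsetP => x; rewrite !inE => /and3P[-> ->].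
    rewrite D0 subset0 in AD.
    by rewrite (indpoly_rec _ ok_sym vS) D0 (eqP AD) indpoly0 !hornerE subrr.
  have [b [b0 rb _] H] := IH _ ltD D0.
  exists b; split => //; rewrite (indpoly_rec _ ok_sym vS) !hornerE rb sub0r oppr_le0.
  rewrite mulr_ge0 ?(ltW b0) // leNgt; apply/negP => lt0.
  have AD : avoid ok S v \subset S :\ v.
    by apply/subsetP => x; rewrite !inE => /and3P[-> ->].
  have [|||c [c0 rc _] cb] := @first_root_exists (I (avoid ok S v)) b.
  - by rewrite indpoly_horner0.
  - by [].
  - exact: ltW.
  have [ecb|ncb] := eqVneq c b; first by rewrite -ecb rc ltxx in lt0.
  by have := H _ AD c; rewrite rc ltxx (ltW c0) lt_neqAle ncb cb => /(_ isT).
have [v vS] := set0Pn _ S0.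
have [b [b0 Sb _]] := step v vS.
have [|c cP cb] := first_root_exists _ b0 Sb; first by rewrite indpoly_horner0.
exists c => // A AS t tI.
have [->|nAS] := eqVneq A S; first by case: cP => _ _; apply.
(* A proper subset misses some [x], so [step] at [x] makes [I A] positive up to [b']. The first root
   found below [b'] equals [c] by uniqueness, hence [c <= b']. *)
have /properP[_ [x xS xA]] : A \proper S by rewrite properEneq nAS.
have [b' [b'0 Sb' H]] := step x xS; apply: H.
  by rewrite subsetD1 AS.
have [|c' c'P c'b] := first_root_exists _ b'0 Sb'; first by rewrite indpoly_horner0.
by case/andP: tI => -> tc; rewrite (lt_le_trans tc) // (first_root_uniq cP c'P).
Qed.

(** A negative value at [b] would force a root of [I A] strictly before [b], where [I A] is positive
    for every [A \subset S]. *)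
Lemma indpoly_ge0_first_root S b A : first_root (I S) b -> A \subset S ->
  0 <= (I A).[b].
Proof.
move=> bP AS; have S0 : S != set0.
  by apply: contraPneq bP => -> [_ /eqP]; rewrite indpoly0 hornerC oner_eq0.
have [c cP H] := indpoly_first_root S0.
rewrite -(first_root_uniq bP cP) in H; case: bP => b0 _ _.
rewrite leNgt; apply/negP => lt0.
have [|d [d0 rd _] db] := @first_root_exists (I A) b _ b0 (ltW lt0).
  by rewrite indpoly_horner0.
have [edb|ndb] := eqVneq d b; first by rewrite -edb rd ltxx in lt0.
by have := H _ AS d; rewrite rd ltxx (ltW d0) lt_neqAle ndb db => /(_ isT).
Qed.

(* If [A] is a minimal set with [I A] vanishing at [b] and [v] is a neighbour of
   [A] in [S], then the recurrence makes [I (v |: A)] negative at [b]. *)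
Lemma indpoly_gt0_first_root S b :
  (forall A, A \proper S -> A != set0 ->
     exists v x, [/\ v \in S :\: A, x \in A & ~~ ok v x]) ->
  first_root (I S) b -> forall A, A \proper S -> 0 < (I A).[b].
Proof.
move=> conn bP A; have [n] := ubnP #|A|; elim: n A => // n IH A ltn AS.
have := indpoly_ge0_first_root bP (proper_sub AS).
rewrite le_eqVlt => /orP[/eqP IA|//]; have b0 : 0 < b by case: bP.
have A0 : A != set0.
  by apply: contra_eqN IA => /eqP ->; rewrite indpoly0 hornerC eq_sym oner_eq0.
have [v [x [/setDP[vS vA] xA nok]]] := conn A AS A0.
have vAS : v |: A \subset S by rewrite subUset sub1set vS proper_sub.
have := indpoly_ge0_first_root bP vAS.
rewrite (indpoly_rec _ ok_sym (setU11 v A)) setU1K // !hornerE -IA sub0r.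
rewrite oppr_ge0 pmulr_rle0 // leNgt => /negP[].
have sA : avoid ok (v |: A) v \proper A.
  apply/properP; split; last by exists x; rewrite // !inE (negPf nok) !andbF.
  by apply/subsetP => y; rewrite !inE => /andP[/orP[/eqP->|//]]; rewrite eqxx.
apply: IH; first exact: leq_trans (proper_card sA) ltn.
exact: proper_trans sA AS.
Qed.

End FirstRoot.

(** * Deletion of a clique *)

Section Clique.
Variables (R : comNzRingType) (T : finType) (ok : rel T).
Hypothesis ok_sym : symmetric ok.

(** Iterates [indpoly_rec] over [K]. Deleting one member of [K] does not affect [avoid ok S k] for
    another member [k], because that set contains no element of [K]. *)
Lemma indpoly_clique (S K : {set T}) : K \subset S ->
  {in K &, forall x y, x != y -> ~~ ok x y} ->
  indpoly R ok S =
    indpoly R ok (S :\: K) - 'X * \sum_(k in K) indpoly R ok (avoid ok S k).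
Proof.
have [n] := ubnP #|K|; elim: n K S => // n IH K S ltn KS H.
have [->|[k kK]] := set_0Vmem K; first by rewrite setD0 big_set0 mulr0 subr0.
rewrite (indpoly_rec _ ok_sym (subsetP KS _ kK)) (IH (K :\ k)).
- rewrite [in RHS](big_setD1 k) //= mulrDr [_ + 'X * _ in RHS]addrC opprD addrA.
  congr (_ - _ * _ - _).
    by congr indpoly; apply/setP => x; rewrite !inE; case: eqVneq => [->|]; rewrite ?kK ?andbF.
  apply: eq_bigr => j /setD1P[jk jK]; congr indpoly; apply/setP => x; rewrite !inE.
  case: eqVneq => [->|//]; rewrite (negPf (H _ _ jK kK jk)) !andbF //.
- exact: leq_trans (proper_card (properD1 kK)) ltn.
- exact: setSD.
- by move=> x y /setD1P[_ xK] /setD1P[_ yK]; apply: H.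
Qed.

End Clique.

(** * The adjacency tensor and positive eigenvectors *)

Section Perron.
Variables (R : realType) (V : finType) (r : nat) (E : {set {set V}}).
Hypotheses (r_gt0 : (0 < r)%N) (unifE : uniform r E).
Local Notation C := R[i].
Local Notation normc := ComplexField.Normc.normc.

(** Since [i :: t] has exactly [r] entries, its support is the [r]-set [e] only if it lists [e]
    without repetition. *)
Lemma tuple_set_eq (i : V) (e : {set V}) (t : (r.-1).-tuple V) :
  #|e| = r -> i \in e ->
  ([set j | j \in i :: t] == e) = all (mem (e :\ i)) t && uniq t.
Proof.
move=> ce ie; have st : size (i :: t) = r by rewrite /= size_tuple prednK.
apply/eqP/andP => [te|[/allP te ut]].
  have /andP[it ut] : uniq (i :: t).
    apply/card_uniqP; rewrite st; transitivity #|e|; last by [].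
    by rewrite -te; apply: eq_card => x; rewrite inE.
  split => //; apply/allP => x xt; rewrite /= !inE -te !inE xt orbT andbT.
  by apply: contraNneq it => <-.
have it : i \notin t by apply/negP => /te /=; rewrite !inE eqxx.
apply/eqP; rewrite eqEcard; apply/andP; split.
  by apply/subsetP => x; rewrite !inE => /orP[/eqP->//|/te /=]; rewrite !inE => /andP[].
have /card_uniqP cit : uniq (i :: t) by rewrite /= it.
apply: (@leq_trans #|i :: t|); first by rewrite cit st ce.
by rewrite subset_leq_card //; apply/subsetP => x; rewrite inE.
Qed.

(** Each edge through [i] comes from [(r-1)!] tuples, which cancels the normalisation of the tensor
    entries. *)
Lemma tensor_sumE (x : V -> C) (i : V) :
  \sum_(t : (r.-1).-tuple V) adj_entry R r E (i :: t) * \prod_(j <- t) x j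
  = \sum_(e in E | i \in e) \prod_(j in e :\ i) x j.
Proof.
rewrite (bigID (fun t : _.-tuple V => [set j | j \in i :: t] \in E)) /=.
rewrite [X in _ + X]big1 ?addr0; last first.
  by move=> t tE; rewrite /adj_entry (negPf tE) mul0r.
rewrite (partition_big (fun t : _.-tuple V => [set j | j \in i :: t])
  (fun e => (e \in E) && (i \in e))) /=; last by move=> t ->; rewrite !inE eqxx.
apply: eq_bigr => e /andP[eE ie].
have ce := unifE eE.
transitivity (\sum_(t in [set t : (r.-1).-tuple V | all (mem (e :\ i)) t & uniq t])
   ((r.-1)`!%:R^-1 * \prod_(j in e :\ i) x j)).
  apply: eq_big => [t|t].
    rewrite inE -(tuple_set_eq _ ce ie).
    by case: eqP => [->|]; rewrite ?andbF // eE.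
  move=> /andP[tE]; rewrite /adj_entry tE (tuple_set_eq _ ce ie) => /andP[/allP te ut].
  congr (_ * _); rewrite big_uniq //; apply: eq_bigl => j.
  suff /subset_cardP H : #|mem t| = #|mem (e :\ i)|.
    have /H -> // : mem t \subset mem (e :\ i) by apply/subsetP => y /te.
  move/card_uniqP: ut => ->; rewrite size_tuple.
  by move: ce; rewrite (cardsD1 i) ie => <-.
rewrite sumr_const card_uniq_tuples.
have -> : #|mem (e :\ i)| = r.-1 by move: ce; rewrite (cardsD1 i) ie => <-.
rewrite ffactnn -[LHS]mulr_natl mulrA mulfV ?mul1r //.
by rewrite pnatr_eq0 -lt0n fact_gt0.
Qed.

Lemma normC_normc (z : C) : `|z| = (normc z)%:C%C.
Proof. by case: z. Qed.

Lemma normc_real (a : R) : 0 <= a -> normc a%:C%C = a.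
Proof. by move=> a0; rewrite /= expr0n addr0 sqrtr_sqr ger0_norm. Qed.

(* Collatz-Wielandt: compare [|y|] with [x] at a vertex where [|y i| / x i] is
   maximal. *)
Lemma spectral_radius_positive_eigenvector (x : V -> R) (l : R) (v0 : V) : 0 <= l ->
  (forall i, 0 < x i) ->
  (forall i, \sum_(e in E | i \in e) \prod_(j in e :\ i) x j = l * x i ^+ r.-1) ->
  spectral_radius R r E = l.
Proof.
move=> l0 x0 Hx; have ex_l : tensor_eigenvalue r E l%:C%C.
  exists (fun i => (x i)%:C%C); split.
    by exists v0; apply: contraTneq (x0 v0) => -[->]; rewrite ltxx.
  move=> i; rewrite tensor_sumE -rmorphXn -rmorphM /= -Hx rmorph_sum.
  by apply: eq_bigr => e _; rewrite rmorph_prod.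
have ub m : tensor_eigenvalue r E m -> normc m <= l.
  move=> [y [[k yk] Hy]]; pose z i := normc (y i) / x i.
  have z_max : exists i, forall j, z j <= z i.
    have [i _ iP] := @arg_maxP _ _ _ k xpredT z isT.
    by exists i => j; apply: iP.
  have [i iP] := z_max; have zi0 : 0 < z i.
    apply: lt_le_trans (iP k); rewrite divr_gt0 // lt_neqAle.
    have : (0 : C) <= `|y k| by [].
    rewrite normC_normc lecR => ->; rewrite andbT eq_sym.
    by apply: contraNneq yk => /ComplexField.Normc.eq0_normc ->.
  have yE j : normc (y j) = z j * x j by rewrite divfK // gt_eqF.
  have := congr1 Num.norm (Hy i); rewrite tensor_sumE normrM normrX => e1.
  (* Every [|y j|] is at most [z i * x j], so the equation for [y] at [i] is dominated by the one
     for [x] scaled by [z i]. *)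
  have : `|m| * `|y i| ^+ r.-1 <= (l * (z i * x i) ^+ r.-1)%:C%C.
    rewrite -e1 exprMn mulrCA -Hx mulr_sumr; apply: le_trans (ler_norm_sum _ _ _) _.
    rewrite rmorph_sum; apply: ler_sum => e /andP[eE ie].
    have -> : r.-1 = #|e :\ i| by move: (unifE eE); rewrite (cardsD1 i) ie => <-.
    rewrite -prodr_const -big_split normr_prod rmorph_prod /=.
    apply: ler_prod => j _; rewrite normr_ge0 normC_normc yE lecR /=.
    by rewrite ler_wpM2r // ltW.
  rewrite !normC_normc -rmorphXn -rmorphM lecR yE ler_pM2r //.
  by rewrite exprn_gt0 // mulr_gt0.
rewrite /spectral_radius; apply/eqP; rewrite eq_le; apply/andP; split.
  apply: ge_sup; first by exists l, l%:C%C => //; rewrite normc_real.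
  by move=> _ [m mP <-]; apply: ub.
apply: ub_le_sup; first by exists l => _ [m mP <-]; apply: ub.
by exists l%:C%C => //; rewrite normc_real.
Qed.

End Perron.

(** * Spectral radius of branching hypergraphs *)

Section Hypertree.
Variable V : finType.
Implicit Types (E : {set {set V}}) (e f : {set V}).

Definition disj : rel {set V} := fun e f => [disjoint e & f].

Lemma disj_sym : symmetric disj.
Proof. by move=> e f; rewrite /disj disjoint_sym. Qed.

(* The hypergraph without [e] retracts onto [e], each component going to the
   vertex of [e] it contains: for connected hypergraphs this is acyclicity. *)
Definition branching E := forall e, e \in E -> exists c : V -> V,
  [/\ forall x, c x \in e, {in e, forall x, c x = x} &
      forall f, f \in E -> f != e -> {in f &, forall x y, c x = c y}].

Definition hdel E (v : V) := [set e in E | v \notin e].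

(* Removing [e] splits the tree into branches [T_v], one for each [v \in e].
   Writing [s v] for the polynomial of [T_v] and [d v] for that of [T_v] minus
   [v], the factor at [v] is [d v * \prod_(u != v) s u]. *)
Lemma branching_prod (R : comNzRingType) E e : set0 \notin E -> branching E ->
  e \in E ->
  \prod_(v in e) indpoly R disj (hdel E v) =
    indpoly R disj (avoid disj E e) * indpoly R disj (E :\ e) ^+ #|e|.-1.
Proof.
move=> E0 br eE; have [c [ce cid cE]] := br e eE.
have [v0 v0e] : exists v, v \in e.
  by apply/set0Pn; apply: contraNneq E0 => <-.
(* [b f] is the vertex of [e] whose branch contains [f]. The default [v0] would only occur for an
   empty edge. *)
pose b f := c (odflt v0 [pick x in f]).
have bE f x : f \in E -> f != e -> x \in f -> b f = c x.
  move=> fE fe xf; rewrite /b; case: pickP => [y yf|/(_ x)]; last by rewrite xf.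
  exact: cE fE fe _ _ yf xf.
have disjE f g : f \in E -> f != e -> g \in E -> g != e -> b f != b g -> disj f g.
  move=> fE fe gE ge; rewrite /disj -setI_eq0; apply: contra_neqT.
  case/set0Pn => y /setIP[yf yg]; by rewrite (bE f y) // (bE g y).
have cls (S : {set {set V}}) : S \subset E :\ e ->
    indpoly R disj S = \prod_(v in e) indpoly R disj [set f in S | b f == v].
  move=> SE; apply: indpoly_classes => [|f g fS gS|f _]; first exact: disj_sym.
    have /setD1P[fe fE] := subsetP SE _ fS; have /setD1P[ge gE] := subsetP SE _ gS.
    exact: disjE.
  exact: ce.
pose s v := indpoly R disj [set f in E :\ e | b f == v].
pose d v := indpoly R disj [set f in E :\ e | (b f == v) && (v \notin f)].
have inE_b f v : f \in E :\ e -> v \in e -> v \in f -> b f = v.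
  by move=> /setD1P[fe fE] ve vf; rewrite (bE f v) // cid.
have -> : indpoly R disj (avoid disj E e) = \prod_(v in e) d v.
  rewrite cls; last by apply/subsetP => f; rewrite !inE => /and3P[-> ->].
  apply: eq_bigr => v ve; congr indpoly; apply/setP => f; rewrite !inE /disj.
  have [fe|fe] := eqVneq f e; first by rewrite andbF.
  rewrite /=; have [fE|//] := boolP (f \in E).
  rewrite /= andbC; case: eqP => //= bf; apply/idP/idP => [ef|vf].
    by rewrite (disjointFr ef).
  rewrite -setI_eq0; apply: contraNT vf => /set0Pn[y /setIP[ye yf]].
  by rewrite -bf (inE_b f y) // !inE fe.
have -> : indpoly R disj (E :\ e) = \prod_(v in e) s v by exact: cls.
have del v : v \in e ->
    indpoly R disj (hdel E v) = d v * \prod_(u in e | u != v) s u.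
  move=> ve; rewrite cls; last first.
    apply/subsetP => f; rewrite !inE => /andP[-> vf]; rewrite andbT.
    by apply: contraNneq vf => ->.
  rewrite (bigD1 v) //=; congr (_ * _).
    congr indpoly; apply/setP => f; rewrite !inE.
    have [->|fe] := eqVneq f e; first by rewrite ve andbF.
    by rewrite /= -andbA; case: (f \in E) => //=; rewrite andbC.
  apply: eq_bigr => u /andP[ue uv]; congr indpoly; apply/setP => f; rewrite !inE.
  have [->|fe] := eqVneq f e; first by rewrite ve andbF.
  have [fE|//] := boolP (f \in E); rewrite /= andbC.
  case: eqP => //= bf; apply: contra uv => vf.
  by rewrite -bf (inE_b f v) // !inE fe.
rewrite (eq_bigr _ del) big_split /=; congr (_ * _).
(* In the double product each [s u] occurs once for every [v] in [e] other than [u]. *)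
rewrite (exchange_big_dep (mem e)) /=; last by move=> v u _ /andP[].
rewrite -prodrXl; apply: eq_bigr => u ue.
have {}ue : u \in e by [].
rewrite prodr_const (cardsD1 u e) ue; congr (_ ^+ _).
by apply: eq_card => v; rewrite !inE unfold_in /= [u == v]eq_sym andbC.
Qed.

(** The edges through [v] pairwise meet, so they form a clique of the line graph. *)
Lemma indpoly_hdel (R : comNzRingType) E v :
  indpoly R disj E = indpoly R disj (hdel E v)
    - 'X * \sum_(e in E | v \in e) indpoly R disj (avoid disj E e).
Proof.
have KE : [set e in E | v \in e] \subset E.
  by apply/subsetP => e; rewrite inE => /andP[].
rewrite (indpoly_clique R disj_sym KE) => [|e f].
  congr (indpoly _ _ _ - _ * _); last by apply: eq_bigl => e; rewrite inE.
  by apply/setP => e; rewrite !inE; case: (e \in E); rewrite ?andbF //= andbT.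
rewrite !inE => /andP[_ ve] /andP[_ vf] _; apply/negP => /disjointFr /(_ ve).
by rewrite vf.
Qed.

Lemma connected_edge E v e : hconnected E -> e \in E -> (1 < #|e|)%N ->
  exists2 f, f \in E & v \in f.
Proof.
move=> conn eE /card_gt1P[x [y [xe ye xy]]].
have [z zv] : exists z, z != v.
  by have [xv|] := eqVneq x v; [exists y; rewrite -xv eq_sym | exists x].
(* As [z != v], the path has a first step, and the edge of that step contains [v]. *)
have /connectP[[|a p]] := conn v z; first by move=> _ /= zE; rewrite zE eqxx in zv.
move=> /= /andP[+ _] _ => /exists_inP[f fE /andP[vf _]].
by exists f.
Qed.

(** Connectivity of the line graph, in the form asked by [indpoly_gt0_first_root]: along a path from
    an edge in [A] to one outside, take the first edge that leaves [A]. *)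
Lemma connected_meet E (A : {set {set V}}) : set0 \notin E -> hconnected E ->
  A \proper E -> A != set0 ->
  exists f e, [/\ f \in E :\: A, e \in A & ~~ disj f e].
Proof.
move=> E0 conn /properP[AE [g gE gA]] /set0Pn[e eA].
have memE f : f \in E -> exists x, x \in f.
  by move=> fE; apply/set0Pn; apply: contraNneq E0 => <-.
have [x xe] := memE e (subsetP AE _ eA); have [y yg] := memE g gE.
have nd f (h : {set V}) z : z \in f -> z \in h -> ~~ disj f h.
  by move=> zf zh; apply/negP => /disjointFr /(_ zf); rewrite zh.
have /connectP[p] := conn x y; elim: p x e eA xe => [|a p IH] x e eA xe /=.
  by move=> _ xy; exists g, e; split; rewrite ?inE ?gA // (nd _ _ y) // xy.
move=> /andP[/exists_inP[f fE /andP[xf af]] pP] yE.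
have [fA|fA] := boolP (f \in A); first exact: IH fA af pP yE.
by exists f, e; split; rewrite ?inE ?fA // (nd _ _ x).
Qed.

Lemma rcf_root (R : rcfType) n (a : R) : (0 < n)%N -> 0 < a ->
  exists2 x : R, 0 < x & x ^+ n = a.
Proof.
move=> n0 a0; have a1 : 0 <= 1 + a by rewrite addr_ge0 // ltW.
(* The upper end [1 + a] works because its [n]-th power is at least [1 + a]. *)
have [|x + /rootP] := @polyrcf.poly_ivt R ('X^n - a%:P) 0 (1 + a) a1.
  rewrite !hornerE expr0n eqn0Ngt n0 sub0r nmulr_rle0 ?oppr_lt0 //.
  rewrite subr_ge0 -(prednK n0) exprS; apply: (@le_trans _ _ (1 + a)).
    by rewrite lerDr.
  by rewrite ler_peMr // exprn_ege1 // lerDl ltW.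
rewrite in_itv /= !hornerE => /andP[x0 _] /subr0_eq xn.
exists x => //; rewrite lt_neqAle x0 andbT; apply: contraTneq a0 => x00.
by rewrite -xn -x00 expr0n eqn0Ngt n0 ltxx.
Qed.

(* The positive eigenvector is [x v = (indpoly (hdel E v)).[b] ^ (1/r)], and
   [branching_prod] turns [\prod_(v in e) x v] into a multiple of the value at
   [b] of the polynomial of the edges disjoint from [e]. *)
Lemma spectral_radius_hypertree (R : realType) r E : (1 < r)%N -> E != set0 ->
  uniform r E -> hconnected E -> branching E ->
  exists b, [/\ first_root (indpoly R disj E) b, 0 < spectral_radius R r E &
    spectral_radius R r E ^+ r * b = 1].
Proof.
move=> r1 En unif conn br; have r0 : (0 < r)%N by apply: ltnW.
have E0 : set0 \notin E.
  by apply/negP => /unif; rewrite cards0 => r00; rewrite -r00 in r0.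
have [b bP _] := @indpoly_first_root R _ _ disj_sym _ En.
have gt0 := indpoly_gt0_first_root disj_sym (fun A => connected_meet E0 conn) bP.
have [b0 rb _] := bP.
have [l l0 lr] : exists2 l : R, 0 < l & l ^+ r = b^-1.
  by apply: rcf_root => //; rewrite invr_gt0.
have lb : l ^+ r * b = 1 by rewrite lr mulVf // gt_eqF.
have [e0 e0E] := set0Pn _ En.
have e0r := unif e0 e0E.
have [v0 _] : exists v, v \in e0 by apply/set0Pn; apply: contraNneq E0 => <-.
pose m v := (indpoly R disj (hdel E v)).[b].
pose q e := (indpoly R disj (avoid disj E e)).[b].
have m0 v : 0 < m v.
  apply: gt0; have [|f fE vf] := connected_edge v conn e0E; first by rewrite e0r.
  apply/properP; split; last by exists f; rewrite // inE vf andbF.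
  by apply/subsetP => e; rewrite inE => /andP[].
have q0 e : e \in E -> 0 < q e.
  move=> eE; apply: gt0; apply/properP; split; first exact: subset_avoid.
  by exists e; rewrite // !inE eqxx andbF.
have [x xP] : exists x : V -> R, forall v, 0 < x v /\ x v ^+ r = m v.
  apply: (fin_all_exists (P := fun v y => 0 < y /\ y ^+ r = m v)) => v.
  by have [y y0 yE] := rcf_root r0 (m0 v); exists y.
(* Both sides are nonnegative, so [r]-th powers are compared. At the root [b] the polynomial of
   [E :\ e] has value [b * q e], so [branching_prod] gives [q e * (b * q e) ^+ r.-1], which is the
   right side's power as [l ^+ r * b = 1]. *)
have prodE e : e \in E -> \prod_(v in e) x v = b * l * q e.
  move=> eE; apply/eqP; rewrite -(@eqrXn2 _ r) //.
  - rewrite -prodrXl (eq_bigr m) => [|v _]; last by case: (xP v).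
    have := congr1 (fun p => p.[b]) (branching_prod R E0 br eE).
    have -> : (indpoly R disj (E :\ e) ^+ #|e|.-1) =
       (indpoly R disj E + 'X * indpoly R disj (avoid disj E e)) ^+ #|e|.-1.
      by rewrite (indpoly_rec R disj_sym eE) subrK.
    rewrite horner_prod /= !hornerE rb add0r => ->; apply/eqP.
    rewrite (unif e eE) -/(q e) !exprMn.
    have eS (y : R) : y ^+ r = y * y ^+ r.-1 by rewrite -exprS prednK.
    transitivity ((l ^+ r * b) * (q e * (b ^+ r.-1 * q e ^+ r.-1))).
      by rewrite lb mul1r.
    by rewrite (eS b) (eS (q e)); ring.
  - by apply: prodr_ge0 => v _; apply: ltW; case: (xP v).
  - by rewrite !mulr_ge0 // ltW // q0.
have eig i : \sum_(e in E | i \in e) \prod_(j in e :\ i) x j = l * x i ^+ r.-1.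
  have [xi0 xir] := xP i; apply: (mulfI (lt0r_neq0 xi0)).
  rewrite mulr_sumr mulrCA -exprS prednK // xir.
  transitivity (\sum_(e in E | i \in e) b * l * q e).
    apply: eq_bigr => e /andP[eE ie]; rewrite -prodE //.
    by rewrite [in RHS](bigD1 i) //=; congr (_ * _); apply: eq_bigl => j; rewrite !inE andbC.
  rewrite -mulr_sumr -mulrA mulrCA; congr (_ * _).
  (* At the root, the expansion at [i] says that [m i] is [b] times the sum of [q e] over the edges
     through [i]. *)
  have := congr1 (fun p => p.[b]) (indpoly_hdel R E i).
  by rewrite rb !hornerE -/(m i) => /esym/subr0_eq ->; rewrite horner_sum.
have -> := spectral_radius_positive_eigenvector r0 unif v0 (ltW l0) (fun i => proj1 (xP i)) eig.
by exists b.
Qed.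

End Hypertree.

(** * From acyclicity to branching *)

(** A chord from position [i] to position [j + 1] would replace at least two steps by one. *)
Lemma shortest_path_chordless (T : eqType) (g : rel T) x p :
  path g x p ->
  (forall q, path g x q -> last x q = last x p -> (size p <= size q)%N) ->
  forall i j, (i < j < size p)%N -> ~~ g (nth x (x :: p) i) (nth x (x :: p) j.+1).
Proof.
move=> gp min_p i j /andP[ij jp]; apply/negP => gij.
have lt_ip : (i < size p)%N by apply: ltn_trans jp.
have gi : path g x (take i p) by move: gp; rewrite -{1}(cat_take_drop i p) cat_path => /andP[].
have li : last x (take i p) = nth x (x :: p) i.
  by rewrite (last_nth x) -[x :: take i p]/(take i.+1 (x :: p)) size_takel ?nth_take // ltnW.
have dj : drop j p = nth x p j :: drop j.+1 p by rewrite (drop_nth x).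
have lj : last x (take j.+1 p) = nth x p j.
  by rewrite (last_nth x) -[x :: take j.+1 p]/(take j.+2 (x :: p)) size_takel ?nth_take.
have gj : path g (nth x p j) (drop j.+1 p).
  by move: gp; rewrite -{1}(cat_take_drop j.+1 p) cat_path lj => /andP[].
have := min_p (take i p ++ drop j p); rewrite cat_path gi li dj /= gj gij.
rewrite last_cat /= => /(_ isT); rewrite size_cat /= size_takel ?size_drop; last exact: ltnW.
suff -> : last (nth x p j) (drop j.+1 p) = last x p by move=> /(_ erefl); lia.
by rewrite -[in RHS](cat_take_drop j.+1 p) last_cat lj.
Qed.

Section Acyclic.
Variable V : finType.
Implicit Types (E : {set {set V}}) (e f : {set V}).

Lemma hadj_sym E : symmetric (hadj E).
Proof.
by move=> x y; apply/exists_inP/exists_inP => -[f fE /andP[xf yf]]; exists f; rewrite ?xf ?yf.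
Qed.

(** A shortest path from [u] to [v] avoiding [e], closed up by [e], is a Berge cycle. Chordlessness
    makes its vertices and edges distinct. *)
Lemma acyclic_bridge E e u v : acyclic E -> e \in E -> u \in e -> v \in e ->
  u != v -> ~~ connect (hadj (E :\ e)) u v.
Proof.
move=> acE eE ue ve uv; apply/negP => /connectP[p0 gp0 lp0].
pose g := hadj (E :\ e).
have ex : exists n, [exists p : n.-tuple V, path g u p && (last u p == v)].
  by exists (size p0); apply/existsP; exists (in_tuple p0); rewrite gp0 lp0 eqxx.
case: (ex_minnP ex) => n /existsP[[p /= /eqP sp] /andP[gp /eqP lp]] min_n.
have chordless := @shortest_path_chordless _ g u p gp.
have {}chordless i j : (i < j < size p)%N -> ~~ g (nth u (u :: p) i) (nth u (u :: p) j.+1).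
  apply: chordless => q gq lq; rewrite sp; apply: min_n; apply/existsP.
  by exists (in_tuple q); rewrite /= gq lq lp eqxx.
case: p sp gp lp chordless => [|a p] sp gp lp; first by rewrite -lp eqxx in uv.
set s := u :: a :: p; set m := size (a :: p) => chordless.
have lv : nth u s m = v by rewrite -lp (last_nth u).
pose P i f := [&& f \in E :\ e, nth u s i \in f & nth u s i.+1 \in f].
(* [F i] is an edge carrying step [i] of the path; the default [e] never occurs for [i < m]. *)
pose F i := odflt e [pick f | P i f].
have FP i : (i < m)%N -> P i (F i).
  move=> im; rewrite /F; case: pickP => [f //|noF].
  have /exists_inP[f fE /andP[xf yf]] := pathP u gp i im.
  by have := noF f; rewrite /P fE xf yf.
(* An edge shared by steps [i] and [j] contains the start of one and the end of the other, which
   yields a chord. *)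
have gF i j x y : (i < m)%N -> F i = F j -> x = nth u s i -> y = nth u s j.+1 ->
    (j < m)%N -> g x y.
  move=> im Fij -> -> jm; apply/exists_inP; exists (F i).
    by case/and3P: (FP i im).
  case/and3P: (FP i im) => _ -> _; rewrite Fij.
  by case/and3P: (FP j jm).
have Finj i j : (i < j)%N -> (j < m)%N -> F i <> F j.
  move=> ij jm Fij; have im := ltn_trans ij jm.
  have := chordless i j; rewrite ij jm => /(_ isT) /negP[].
  exact: gF Fij _ _ jm.
(* If positions [i < j] carry the same vertex, step [j] is a chord starting at [i]. For [j = m]
   there is no such step: step [i - 1] then leads to the last vertex, and [i = 0] would mean
   [u = v]. *)
have sinj i j : (i < j)%N -> (j <= m)%N -> nth u s i <> nth u s j.
  move=> ij jm sij; have [jm'|jm'] := ltnP j m.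
    have := chordless i j; rewrite ij jm' => /(_ isT) /negP[].
    exact: (gF j j _ _ jm' erefl sij erefl jm').
  have jE : j = m by apply/eqP; rewrite eqn_leq jm.
  case: i ij sij => [|i] ij sij.
    by move: uv; rewrite -lv -jE -sij eqxx.
  case: j ij jm sij jm' jE => // j; rewrite ltnS => ij jm sij _ jE.
  have := chordless i j; rewrite ij jm => /(_ isT) /negP[].
  apply: (gF i i _ _ _ erefl erefl) => //; exact: ltn_trans ij jm.
pose vs (i : 'I_(size p).+2) := nth u s i.
(* There are [m + 1] vertices and [m] steps; the last index [m] receives [e], which joins [v] back
   to [u]. *)
pose es (i : 'I_(size p).+2) := if (i < m)%N then F i else e.
apply: (acE (size p) vs es); split.
- move=> i j sij; apply/val_inj; case: (ltngtP i j) => // lt_ij.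
    by case: (sinj i j); rewrite // -ltnS.
  by case: (sinj j i); rewrite // -ltnS.
- have FNe i : (i < m)%N -> F i <> e.
    by move=> /FP /and3P[/setD1P[/eqP]].
  move=> i j; rewrite /es; case: (ltnP i m) => im; case: (ltnP j m) => jm Fij.
  + apply/val_inj; case: (ltngtP i j) => // lt_ij; first by case: (Finj i j).
    by case: (Finj j i).
  + by case: (FNe i im).
  + by case: (FNe j jm).
  + by apply/val_inj/eqP; rewrite eqn_leq (leq_trans _ jm) ?(leq_trans _ im) // -ltnS ltn_ord.
- move=> i; rewrite /es; case: ltnP => // /FP /and3P[/setD1P[_ FE]] //.
move=> i; rewrite /es /vs; case: ltnP => im.
  case/and3P: (FP i im) => _ ->; suff -> : nth u s (ordS i) = nth u s i.+1 by [].
  by rewrite /= modn_small.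
have -> : (i : nat) = m by apply/eqP; rewrite eqn_leq im andbT -ltnS ltn_ord.
have -> : (ordS i : nat) = 0%N.
  have iE : (i : nat) = m by apply/eqP; rewrite eqn_leq im andbT -ltnS ltn_ord.
  by rewrite /= iE modnn.
by rewrite ue lv ve.
Qed.

(** Each vertex goes to the vertex of [e] that it reaches without using [e]: one exists by
    connectivity, and [acyclic_bridge] shows that a vertex of [e] reaches only itself. *)
Lemma supertree_branching r E : (0 < r)%N -> supertree r E -> branching E.
Proof.
move=> r0 [unif conn acE] e eE; pose g := hadj (E :\ e).
have g_sym : connect_sym g by apply: sym_connect_sym; apply: hadj_sym.
have [v0 v0e] : exists v, v \in e.
  by apply/set0Pn; rewrite -card_gt0 (unif e eE).
have reach x : exists2 v, v \in e & connect g x v.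
  have /connectP[p] := conn x v0.
  elim: p x => [|a p IH] x; first by move=> _ /= <-; exists v0.
  (* The path is cut at its first vertex in [e]; earlier steps cannot use [e], as they start outside
     it. *)
  have [xe|xe] := boolP (x \in e); first by exists x.
  move=> /= /andP[/exists_inP[f fE /andP[xf af]] pP] lp.
  have [v ve av] := IH a pP lp; exists v => //; apply: connect_trans av.
  apply: connect1; apply/exists_inP; exists f; last by rewrite xf af.
  by rewrite !inE fE andbT; apply: contraNneq xe => <-.
pose c x := odflt v0 [pick v in e | connect g x v].
have cP x : (c x \in e) && connect g x (c x).
  rewrite /c; case: pickP => [//|noV]; have [v ve xv] := reach x.
  by have := noV v; rewrite /= ve xv.
exists c; split=> [x|x xe|f fE fe x y xf yf].
- by case/andP: (cP x).
- apply/eqP; case/andP: (cP x) => ce; apply: contraTT => cx.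
  by apply: acyclic_bridge; rewrite // eq_sym.
- rewrite /c; congr odflt; apply: eq_pick => v /=; congr (_ && _).
  apply: same_connect => //; apply: connect1; apply/exists_inP; exists f.
    by rewrite !inE fe.
  by rewrite xf yf.
Qed.

End Acyclic.

(** * Coalescence of two hypergraphs *)

Lemma disj_imset (V W : finType) (f : V -> W) : injective f ->
  forall A B : {set V}, disj (f @: A) (f @: B) = disj A B.
Proof.
move=> fI A B; rewrite /disj -!setI_eq0 -imsetI ?imset_eq0 //.
by move=> x y _ _; apply: fI.
Qed.

Lemma connect_hadj_imset (V W : finType) (f : V -> W) (E : {set {set V}})
    (F : {set {set W}}) x y :
  (forall e, e \in E -> f @: e \in F) -> connect (hadj E) x y ->
  connect (hadj F) (f x) (f y).
Proof.
move=> fE /connectP[p]; elim: p x => [|a p IH] x; first by move=> _ ->.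
move=> /= /andP[/exists_inP[e eE /andP[xe ae]] pP] lp.
apply: connect_trans (IH a pP lp); apply: connect1; apply/exists_inP.
by exists (f @: e); rewrite ?fE // !imset_f.
Qed.

Section CoalescenceTheory.
Variables (V1 V2 : finType) (u : V1) (w : V2).
Local Notation W := (coal_vert V1 w).
Local Notation in1 := (fun x : V1 => inl x : W).
Local Notation in2 := (@coal_map2 V1 V2 u w).

(** Each of the two retractions collapses the other side to the identified vertex. *)
Definition retract1 (z : W) : V1 := if z is inl x then x else u.
Definition retract2 (z : W) : V2 := if z is inr y then val y else w.

Lemma in2K : cancel in2 retract2.
Proof.
by move=> x; rewrite /coal_map2; case: insubP => [y _ <-|/negPn/eqP->].
Qed.

Lemma retract1_in2 x : retract1 (in2 x) = u.
Proof. by rewrite /coal_map2; case: insubP. Qed.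

Lemma in2w : in2 w = in1 u.
Proof. by rewrite /coal_map2; case: insubP => // y; rewrite eqxx. Qed.

Lemma in1_inj : injective in1.
Proof. by move=> x y []. Qed.

Lemma coal_vertP (z : W) : (exists x, z = in1 x) \/ (exists y, z = in2 y).
Proof.
case: z => [x|y]; first by left; exists x.
by right; exists (val y); rewrite /coal_map2 valK.
Qed.

Lemma in1_in2 x y : (in1 x == in2 y) = (x == u) && (y == w).
Proof.
apply/eqP/andP => [E|[/eqP-> /eqP->]]; last by rewrite in2w.
have := congr1 retract1 E; rewrite retract1_in2 /= => ->.
by have := congr1 retract2 E; rewrite in2K /= => <-; rewrite !eqxx.
Qed.

Lemma disj_in1_in2 (e : {set V1}) (f : {set V2}) :
  disj [set in1 x | x in e] [set in2 x | x in f] = ~~ ((u \in e) && (w \in f)).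
Proof.
rewrite /disj -setI_eq0; apply/eqP/idP => [E|].
  apply/andP => -[ue wf]; have := in_set0 (in1 u); rewrite -E inE.
  by rewrite imset_f // -in2w imset_f.
apply: contraNeq => /set0Pn[z /setIP[/imsetP[x xe ->] /imsetP[y yf /eqP]]].
by rewrite in1_in2 => /andP[/eqP <- /eqP <-]; rewrite xe.
Qed.

Variables (E1 : {set {set V1}}) (E2 : {set {set V2}}).
Local Notation E := (coal_edges u w E1 E2).
Local Notation im1 := (fun A : {set {set V1}} => [set [set in1 x | x in e] | e : {set V1} in A]).
Local Notation im2 := (fun A : {set {set V2}} => [set [set in2 x | x in e] | e : {set V2} in A]).

Lemma coal_edgesP f : reflect
  ((exists2 e : {set V1}, e \in E1 & f = [set in1 x | x in e]) \/
   (exists2 e : {set V2}, e \in E2 & f = [set in2 x | x in e])) (f \in E).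
Proof.
rewrite inE; apply: (iffP orP) => -[] H; [left|right|left|right]; exact/imsetP.
Qed.

Lemma coal_uniform r : uniform r E1 -> uniform r E2 -> uniform r E.
Proof.
move=> un1 un2 f /coal_edgesP[] [e eE ->].
  by rewrite card_imset ?un1 //; apply: in1_inj.
by rewrite card_imset ?un2 //; apply: can_inj in2K.
Qed.

Lemma coal_connected : hconnected E1 -> hconnected E2 -> hconnected E.
Proof.
move=> conn1 conn2; suff to_u z : connect (hadj E) z (in1 u).
  move=> x y; apply: connect_trans (to_u x) _.
  by rewrite (sym_connect_sym (@hadj_sym _ E)).
case: (coal_vertP z) => [[x ->]|[y ->]].
  by apply: (connect_hadj_imset _ (conn1 x u)) => e eE; apply/coal_edgesP; left; exists e.
rewrite -in2w; apply: (connect_hadj_imset _ (conn2 y w)) => e eE.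
by apply/coal_edgesP; right; exists e.
Qed.

(** Collapse the side not containing the edge, then retract within the other side. Edges of the
    collapsed side go to a single point. *)
Lemma coal_branching : branching E1 -> branching E2 -> branching E.
Proof.
move=> br1 br2 g /coal_edgesP[] [e eE ->].
  have [c [ce cid cE]] := br1 e eE; exists (fun z => in1 (c (retract1 z))); split.
  - by move=> z; apply: (imset_f in1).
  - by move=> _ /imsetP[x xe ->]; rewrite /= cid.
  move=> f /coal_edgesP[] [h hE ->] fe _ _ /imsetP[x xh ->] /imsetP[y yh ->].
    rewrite /= (cE h hE _ x y) //; by apply: contraNneq fe => ->.
  by rewrite !retract1_in2.
have [c [ce cid cE]] := br2 e eE; exists (fun z => in2 (c (retract2 z))); split.
- by move=> z; apply: imset_f.
- by move=> _ /imsetP[x xe ->]; rewrite /= in2K cid.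
move=> f /coal_edgesP[] [h hE ->] fe _ _ /imsetP[x xh ->] /imsetP[y yh ->] //.
rewrite !in2K (cE h hE _ x y) //; by apply: contraNneq fe => ->.
Qed.

(** Edges of the two sides meet only in the identified vertex. Disjoint edges could still coincide
    if empty, which [set0 \notin A] excludes. *)
Lemma indpoly_im (R : comNzRingType) (A : {set {set V1}}) (B : {set {set V2}}) :
  set0 \notin A ->
  {in A & B, forall (e : {set V1}) (f : {set V2}), ~~ ((u \in e) && (w \in f))} ->
  indpoly R (@disj W) (im1 A :|: im2 B) = indpoly R (@disj _) A * indpoly R (@disj _) B.
Proof.
move=> A0 H.
rewrite indpolyM.
- congr (_ * _); apply: indpoly_imset; rewrite ?disj_imset //; try exact: disj_sym.
  + by move=> x y _ _; apply: imset_inj; apply: in1_inj.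
  + by move=> x y _ _; apply: disj_imset; apply: in1_inj.
  + by move=> x y _ _; apply: imset_inj; apply: can_inj in2K.
  + by move=> x y _ _; apply: disj_imset; apply: can_inj in2K.
- exact: disj_sym.
- rewrite -setI_eq0; apply: contraNT A0 => /set0Pn[_ /setIP[/imsetP[e eA ->] /imsetP[f fB ef]]].
  have := H e f eA fB; rewrite -disj_in1_in2 ef /disj -setI_eq0 setIid -ef imset_eq0.
  by move=> /eqP <-.
move=> _ _ /imsetP[e eA ->] /imsetP[f fB ->].
by rewrite disj_in1_in2 H.
Qed.

(** The recurrence at the image of [p], the only edge of [E1] through [u]: once [p] is removed, the
    sides share no vertex of an edge. The edges of [E2] meeting [p] are those through [w]. *)
Lemma indpoly_coal (R : comNzRingType) (p : {set V1}) :
  set0 \notin E1 -> p \in E1 -> u \in p -> (1 < #|p|)%N ->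
  {in E1, forall e : {set V1}, u \in e -> e = p} ->
  indpoly R (@disj _) E =
    indpoly R (@disj _) (E1 :\ p) * indpoly R (@disj _) E2
    - 'X * (indpoly R (@disj _) (avoid (@disj _) E1 p) * indpoly R (@disj _) (hdel E2 w)).
Proof.
move=> E10 pE up p1 only_p; set q := [set in1 x | x in p].
have injL : injective (fun e : {set V1} => [set in1 x | x in e]) by apply/imset_inj/in1_inj.
have qE : q \in E by apply/coal_edgesP; left; exists p.
(* [p] has a vertex besides [u], and that vertex is not in the copy of [V2]. *)
have q2 e : [set in2 x | x in e] != q.
  apply/eqP => eq; move: p1; rewrite (cardsD1 u) up ltnS lt0n cards_eq0.
  case/set0Pn => x /setD1P[xu xp]; have : in1 x \in q by apply: (imset_f in1).
  rewrite -eq => /imsetP[y _ /eqP]; by rewrite in1_in2 (negPf xu).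
rewrite (indpoly_rec _ (@disj_sym _) qE).
have -> : E :\ q = im1 (E1 :\ p) :|: im2 E2.
  apply/setP => f; apply/setD1P/setUP => [[fq /coal_edgesP[] [e eE fe]]|].
  - left; apply/imsetP; exists e => //; rewrite !inE eE andbT.
    by apply: contraNneq fq => ep; rewrite fe ep.
  - by right; apply/imsetP; exists e.
  case=> /imsetP[e + ->]; last by move=> eE; split => //; apply/coal_edgesP; right; exists e.
  case/setD1P=> ep eE; split; last by apply/coal_edgesP; left; exists e.
  by apply: contraNneq ep => /injL ->.
have -> : avoid (@disj _) E q = im1 (avoid (@disj _) E1 p) :|: im2 (hdel E2 w).
  apply/setP => f; rewrite inE; apply/and3P/setUP => [[/coal_edgesP[] [e eE ->] fq qf]|].
  - left; apply/imsetP; exists e => //; rewrite !inE eE -(disj_imset in1_inj) qf andbT.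
    by apply: contraNneq fq => ->.
  - right; apply/imsetP; exists e => //; rewrite !inE eE.
    by move: qf; rewrite disj_in1_in2 up.
  case=> /imsetP[e + ->]; rewrite !inE.
    case/and3P => eE ep pe; split; first by apply/orP; left; apply/imsetP; exists e.
      by apply: contraNneq ep => /injL ->.
    by rewrite (disj_imset in1_inj).
  case/andP=> eE we; split => //; first by apply/orP; right; apply/imsetP; exists e.
  by rewrite disj_in1_in2 up.
rewrite !indpoly_im //.
- by rewrite !inE negb_and (negPf E10).
- move=> e f; rewrite !inE => /and3P[_ _ pe] /andP[_ wf].
  by rewrite (negPf wf) andbF.
- by rewrite !inE negb_and (negPf E10) orbT.
move=> e f /setD1P[ep eE] _; apply/negP => /andP[/(only_p e eE) ee _].
by rewrite ee eqxx in ep.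
Qed.

End CoalescenceTheory.

(** * Structure of the hypergraphs R(a,b,c,d) *)

Lemma disjPn (V : finType) (A B : {set V}) :
  reflect (exists2 z, z \in A & z \in B) (~~ disj A B).
Proof.
rewrite /disj -setI_eq0; apply: (iffP (set0Pn _)) => [[z /setIP[]]|[z zA zB]].
  by exists z.
by exists z; rewrite inE zA.
Qed.

Section RGraphTheory.
Variables (r a b c d : nat).
Local Notation n := (tlen a b c d).
Local Notation V := (Rvert r a b c d).
Local Notation pathv := (pathv r a b c d).
Local Notation path_edge := (@path_edge r a b c d).
Local Notation pend_edge := (@pend_edge r a b c d).
Local Notation Redges := (Redges r a b c d).
Local Notation att := (attach_pos a b c).

Lemma attach_pos_le k : (att k <= n)%N.
Proof. by case: k => -[|[|[|//]]] i; rewrite /attach_pos /= /tlen; lia. Qed.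

Lemma pathv_eq (j : 'I_n.+1) i : (i <= n)%N -> (inl (inl j) == pathv i :> V) = (j == i :> nat).
Proof.
move=> le_in; apply/eqP/eqP => [[->]|<-]; first by rewrite inordK.
by rewrite /Defs.pathv inord_val.
Qed.

Lemma in_path_edge (i : 'I_n) (z : V) : (z \in path_edge i) =
  match z with
  | inl (inl j) => (j == i :> nat) || (j == i.+1 :> nat)
  | inl (inr p) => p.1 == i
  | inr _ => false
  end.
Proof.
have lt_in := ltn_ord i; rewrite !inE.
case: z => [[j|[i' k]]|p].
- rewrite !pathv_eq // 1?ltnW // orbC; case: imsetP => // -[k _ //].
- rewrite /=; apply/imsetP/eqP => [[k' _ [-> _]]|->] //.
  by exists k.
by rewrite /=; apply/negP => /imsetP[].
Qed.

Lemma in_pend_edge (k : 'I_3) (z : V) : (z \in pend_edge k) =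
  match z with
  | inl (inl j) => j == att k :> nat
  | inl (inr _) => false
  | inr p => p.1 == k
  end.
Proof.
rewrite !inE; case: z => [[j|p]|[k' m]].
- rewrite pathv_eq ?attach_pos_le // orbC; case: imsetP => // -[m _ //].
- by rewrite /=; apply/negP => /imsetP[].
rewrite /=; apply/imsetP/eqP => [[m' _ [-> _]]|->] //.
by exists m.
Qed.

Lemma RedgesP e : reflect ((exists i, e = path_edge i) \/ (exists k, e = pend_edge k))
  (e \in Redges).
Proof.
rewrite inE; apply: (iffP orP) => -[].
- by case/imsetP => i _ ->; left; exists i.
- by case/imsetP => k _ ->; right; exists k.
- by case=> i ->; left; apply: imset_f.
- by case=> k ->; right; apply: imset_f.
Qed.

Lemma Redges_uniform : (3 <= r)%N -> uniform r Redges.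
Proof.
move=> r3 e /RedgesP[[i ->]|[k ->]].
  have lt_in := ltn_ord i.
  rewrite cardsU cards2 card_imset ?card_ord => [|x y [] //].
  rewrite /Defs.pathv pathv_eq // inordK ?ltnS 1?ltnW // eqn_leq ltnn andbF.
  rewrite (_ : _ :&: _ = set0); first by rewrite cards0; lia.
  apply/setP => z; rewrite !inE; apply/negP => /andP[zp /imsetP[j _ zE]].
  by move: zp; rewrite zE /Defs.pathv => /orP[] /eqP.
rewrite cardsU1 card_imset ?card_ord => [|x y [] //].
by case: imsetP => [[]//|_]; lia.
Qed.

Lemma Redges_connected : hconnected Redges.
Proof.
have adj e x y : e \in Redges -> x \in e -> y \in e -> connect (hadj Redges) x y.
  by move=> eE xe ye; apply: connect1; apply/exists_inP; exists e; rewrite ?xe.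
have path0 i : (i <= n)%N -> connect (hadj Redges) (pathv i) (pathv 0).
  elim: i => [//|i IH] lt_in; apply: connect_trans (IH (ltnW lt_in)).
  apply: (adj (path_edge (Ordinal lt_in))); first by apply/RedgesP; left; exists (Ordinal lt_in).
    by rewrite !inE eqxx orbT.
  by rewrite !inE eqxx.
have to0 z : connect (hadj Redges) z (pathv 0).
  case: z => [[j|[i k]]|[k m]].
  - by rewrite (_ : inl (inl j) = pathv j) ?path0 -1?ltnS // /Defs.pathv inord_val.
  - apply: connect_trans (path0 i (ltnW (ltn_ord i))); apply: (adj (path_edge i)).
    + by apply/RedgesP; left; exists i.
    + by rewrite in_path_edge.
    + by rewrite !inE eqxx.
  - apply: connect_trans (path0 _ (attach_pos_le k)); apply: (adj (pend_edge k)).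
    + by apply/RedgesP; right; exists k.
    + by rewrite in_pend_edge.
    + by rewrite !inE eqxx.
move=> x y; apply: connect_trans (to0 x) _.
by rewrite (sym_connect_sym (@hadj_sym _ Redges)).
Qed.

(** The end of path edge [i] on the side of path vertex [j]. *)
Definition path_side (i : 'I_n) (j : nat) : V :=
  if (j <= i)%N then pathv i else pathv i.+1.

(** Witness for [branching] at a path edge; [pend_retract] is the one for a pendent edge, where
    everything outside hangs at the attachment vertex. *)
Definition path_retract (i : 'I_n) (z : V) : V :=
  match z with
  | inl (inl j) => path_side i j
  | inl (inr p) => if p.1 == i then z else path_side i p.1.+1
  | inr p => path_side i (att p.1)
  end.

Definition pend_retract (k : 'I_3) (z : V) : V :=
  match z with
  | inr p => if p.1 == k then z else pathv (att k)
  | _ => pathv (att k)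
  end.

Lemma Redges_branching : branching Redges.
Proof.
move=> e /RedgesP[[i ->]|[k ->]].
  have lt_in := ltn_ord i.
  have side_in j : path_side i j \in path_edge i.
    by rewrite /path_side !inE; case: ifP; rewrite eqxx ?orbT.
  exists (path_retract i); split.
  - move=> [[j|p]|p] //=; case: ifP => // pi; by rewrite in_path_edge.
  - move=> [[j|p]|p]; rewrite in_path_edge //=; last by move=> ->.
    case/orP => /eqP ji; rewrite /path_side ji ?leqnn ?ltnn -ji /Defs.pathv;
      by rewrite inord_val.
  move=> f /RedgesP[[i' ->]|[k ->]] fe.
    have ii' : i' != i by apply: contraNneq fe => ->.
    have ii'n : (i' != i :> nat) by [].
    have const z : z \in path_edge i' -> path_retract i z = path_side i i'.+1.
      case: z => [[j|p]|p]; rewrite in_path_edge //=; last first.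
        by move=> /eqP ->; rewrite (negPf ii').
      case/orP => /eqP -> //; rewrite /path_side; move: ii'n; case: ltngtP => //.
    by move=> x y /const -> /const ->.
  have const z : z \in pend_edge k -> path_retract i z = path_side i (att k).
    by case: z => [[j|p]|p]; rewrite in_pend_edge //= => /eqP ->.
  by move=> x y /const -> /const ->.
exists (pend_retract k); split.
- have att_in : pathv (att k) \in pend_edge k by rewrite !inE eqxx.
  by case=> [[j|p]|p]; rewrite /pend_retract; [exact: att_in | exact: att_in |
    case: ifP => [pk|_]; [by rewrite in_pend_edge | exact: att_in]].
- move=> [[j|p]|p]; rewrite in_pend_edge //=; last by move=> ->.
  by move=> /eqP jk; rewrite /Defs.pathv -jk inord_val.
move=> f /RedgesP[[i ->]|[k' ->]] fe.
  by move=> [[j|p]|p] [[j'|p']|p']; rewrite !in_path_edge.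
have kk' : k' != k by apply: contraNneq fe => ->.
have const z : z \in pend_edge k' -> pend_retract k z = pathv (att k).
  by case: z => [[j|p]|p]; rewrite in_pend_edge //= => /eqP ->; rewrite (negPf kk').
by move=> x y /const -> /const ->.
Qed.

(* Path edges are numbered [0 .. n-1] and pendent edges [n .. n+2]. *)
Definition redge (i : nat) : {set V} :=
  if insub i is Some j then path_edge j else pend_edge (inord (i - n)).

Definition redge_disj (i j : nat) : bool :=
  let at_ k := nth 0%N [:: a; a + b; a + b + c]%N (k - n) in
  let meets i k := (at_ k == i) || (at_ k == i.+1) in
  if (i < n)%N then
    if (j < n)%N then (i.+1 < j)%N || (j.+1 < i)%N else ~~ meets i j
  else if (j < n)%N then ~~ meets j i else (i != j) && (at_ i != at_ j).

Lemma redge_path i (lt_in : (i < n)%N) : redge i = path_edge (Ordinal lt_in).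
Proof. by rewrite /redge insubT. Qed.

Lemma redge_pend i : (n <= i)%N -> redge i = pend_edge (inord (i - n)).
Proof. by move=> le_ni; rewrite /redge insubF // ltnNge le_ni. Qed.

Lemma redge_disjE i j : (i < n + 3)%N -> (j < n + 3)%N ->
  disj (redge i) (redge j) = redge_disj i j.
Proof.
have val_att k : (n <= k)%N -> (k < n + 3)%N ->
    att (inord (k - n)) = nth 0%N [:: a; a + b; a + b + c]%N (k - n).
  by move=> nk k3; rewrite /attach_pos inordK //; lia.
have mixed x k (xn : (x < n)%N) : (n <= k)%N -> (k < n + 3)%N ->
    disj (redge x) (redge k) =
    ~~ ((nth 0 [:: a; a + b; a + b + c] (k - n) == x) ||
        (nth 0 [:: a; a + b; a + b + c] (k - n) == x.+1))%N.
  move=> nk k3; rewrite redge_path redge_pend // -val_att //; apply: negb_inj; rewrite negbK.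
  apply/disjPn/idP => [[[[z|z]|z]]|H].
  - by rewrite in_path_edge in_pend_edge => + /eqP <-.
  - by rewrite in_pend_edge.
  - by rewrite in_path_edge.
  exists (pathv (att (inord (k - n)))); last by rewrite !inE eqxx.
  by rewrite in_path_edge /= inordK ?ltnS ?attach_pos_le.
move=> i3 j3; rewrite /redge_disj; case: ltnP => ni; case: ltnP => nj.
- rewrite !redge_path; apply: negb_inj; apply/disjPn/idP => [[[[z|z]|z]]|H].
  + by rewrite !in_path_edge /=; lia.
  + by rewrite !in_path_edge => /eqP -> /eqP [->]; lia.
  + by rewrite in_path_edge.
  (* Equal or consecutive path edges share the left end of the later one. *)
  exists (pathv (maxn i j)); rewrite in_path_edge /= inordK ?ltnS; lia.
- exact: mixed.
- by rewrite disj_sym mixed.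
rewrite !redge_pend // -!val_att //; apply: negb_inj; apply/disjPn/idP => [[[[z|z]|z]]|].
- rewrite !in_pend_edge => /eqP -> /eqP ->; by rewrite eqxx andbF.
- by rewrite in_pend_edge.
- rewrite !in_pend_edge => /eqP -> /eqP /(congr1 val); rewrite /= !inordK; lia.
rewrite negb_and !negbK => H.
have e : att (inord (i - n)) = att (inord (j - n)) by case/orP: H => /eqP ->.
by exists (pathv (att (inord (i - n)))); rewrite !inE ?e eqxx.
Qed.

(** For [r >= 3] each path edge has an inner vertex and each pendent edge a new one; such a vertex
    lies in no other edge. *)
Lemma redge_inj : (3 <= r)%N -> {in [pred i | (i < n + 3)%N] &, injective redge}.
Proof.
move=> r3 i j; rewrite !inE => i3 j3.
have r2 : (0 < r - 2)%N by lia.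
have r1 : (0 < r - 1)%N by lia.
case: (ltnP i n) => ni; case: (ltnP j n) => nj.
- rewrite !redge_path => /setP /(_ (inl (inr (Ordinal ni, Ordinal r2)))).
  by rewrite !in_path_edge /= eqxx => /esym/eqP [].
- rewrite redge_path redge_pend // => /setP /(_ (inl (inr (Ordinal ni, Ordinal r2)))).
  by rewrite in_path_edge in_pend_edge /= eqxx.
- rewrite (redge_path nj) redge_pend // => /setP /(_ (inl (inr (Ordinal nj, Ordinal r2)))).
  by rewrite in_path_edge in_pend_edge /= eqxx.
rewrite !redge_pend // => /setP /(_ (inr (inord (i - n), Ordinal r1))).
rewrite !in_pend_edge /= eqxx => /esym/eqP /(congr1 val); rewrite /= !inordK; lia.
Qed.

Lemma RedgesE : Redges = [set e in [seq redge i | i <- iota 0 (n + 3)]].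
Proof.
apply/setP => e; rewrite [in RHS]inE; apply/RedgesP/mapP => [[[i ->] | [k ->]] | [i + ->]].
- exists (i : nat); first by rewrite mem_iota /=; have := ltn_ord i; lia.
  by rewrite (redge_path (ltn_ord i)); congr path_edge; apply/val_inj.
- exists (n + k)%N; first by rewrite mem_iota /= add0n ltn_add2l.
  by rewrite redge_pend ?leq_addr // addKn inord_val.
move=> _; case: (ltnP i n) => ni; first by left; rewrite redge_path; eexists.
by right; rewrite redge_pend //; eexists.
Qed.

End RGraphTheory.

(** * Numbered line graphs and the comparison of the two hypergraphs *)

(** Moves the polynomial to ['I_m] with a relation [K], where edge families of different hypergraphs
    become comparable. *)
Lemma indpoly_enum (R : comNzRingType) (T : finType) (ok : rel T) (F : nat -> T)
    (s : seq nat) m (K : rel nat) :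
  symmetric ok -> size s = m -> uniq s -> {in s &, injective F} ->
  (forall i j, (i < m)%N -> (j < m)%N -> ok (F (nth 0%N s i)) (F (nth 0%N s j)) = K i j) ->
  indpoly R ok [set x in [seq F i | i <- s]] =
    indpoly R (fun i j : 'I_m => K i j) setT.
Proof.
move=> ok_sym sm us Finj H.
have -> : [set x in [seq F i | i <- s]] = (fun i : 'I_m => F (nth 0%N s i)) @: setT.
  apply/setP => x; rewrite inE; apply/mapP/imsetP => [[k ks ->] | [i _ ->]].
    have ki : (index k s < m)%N by rewrite -sm index_mem.
    by exists (Ordinal ki); rewrite //= nth_index.
  by exists (nth 0%N s i); rewrite // mem_nth ?sm.
apply: indpoly_imset => // [i j|i j _ _|i j _ _]; last exact: H.
  by rewrite -!H // ok_sym.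
move=> /Finj; rewrite !mem_nth ?sm // => /(_ isT isT) /eqP.
by rewrite nth_uniq ?sm // => /eqP /val_inj.
Qed.

(** For [disj], the independent subsets of [E] are its matchings. *)
Lemma coef_indpoly (R : comNzRingType) (V : finType) (E : {set {set V}}) k :
  (indpoly R (@disj V) E)`_k = (-1) ^+ k * (nmatch E k)%:R.
Proof.
have coefNXn m : ((- 'X : {poly R}) ^+ m)`_k = (-1) ^+ m * (k == m)%:R.
  rewrite [(- 'X) ^+ m]exprNn -!(signr_odd _ m).
  by case: (odd m); rewrite /= ?expr0 ?expr1 ?mul1r ?mulN1r ?coefN coefXn.
rewrite /indpoly coef_sum /nmatch -sum1_card natr_sum mulr_sumr.
under eq_bigr => A _ do rewrite coefNXn.
rewrite [LHS](bigID (fun A : {set {set V}} => #|A| == k)) /= [X in _ + X]big1 ?addr0.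
  by apply: eq_big => [A|A /andP[_ /eqP->]]; rewrite ?inE // eqxx.
by move=> A /andP[_ Ak]; rewrite eq_sym (negPf Ak) mulr0.
Qed.

Section NumberedEdges.
Variables (r a b c d : nat).
Hypothesis r3 : (3 <= r)%N.
Local Notation n := (tlen a b c d).
Local Notation F := (redge r a b c d).
Local Notation E := (Redges r a b c d).
Local Notation rd := (redge_disj a b c d).

Lemma Redges_remove k : (k < n + 3)%N ->
  E :\ F k = [set e in [seq F i | i <- iota 0 (n + 3) & i != k]].
Proof.
move=> k3; apply/setP => e; rewrite RedgesE !inE.
apply/andP/mapP => [[ek /mapP[i i3 ei]] | [i + ->]].
  by exists i => //; rewrite mem_filter i3 andbT; apply: contraNneq ek => <-; rewrite ei.
rewrite mem_filter => /andP[ik i3]; split; last exact: map_f.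
by apply: contraNneq ik => /(redge_inj r3) -> //; move: i3; rewrite mem_iota.
Qed.

Lemma Redges_avoid k : (k < n + 3)%N ->
  avoid (@disj _) E (F k) = [set e in [seq F i | i <- iota 0 (n + 3) & (i != k) && rd k i]].
Proof.
move=> k3; apply/setP => e; rewrite RedgesE !inE.
apply/and3P/mapP => [[/mapP[i i3 ->] ek ok] | [i + ->]].
  exists i => //; rewrite mem_filter i3 andbT -(@redge_disjE r) ?ok //.
    by rewrite andbT; apply: contraNneq ek => ->.
  by move: i3; rewrite mem_iota.
rewrite mem_filter => /andP[/andP[ik ki] i3].
have ilt : (i < n + 3)%N by move: i3; rewrite mem_iota.
split; [exact: map_f | | by rewrite redge_disjE].
by apply: contraNneq ik => /(redge_inj r3) ->.
Qed.

Lemma indpoly_redge (R : comNzRingType) (s : seq nat) m (K : rel nat) :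
  [&& size s == m, uniq s, all (fun i => (i < n + 3)%N) s &
    all (fun i => all (fun j => rd (nth 0%N s i) (nth 0%N s j) == K i j) (iota 0 m)) (iota 0 m)] ->
  indpoly R (@disj _) [set e in [seq F i | i <- s]] =
    indpoly R (fun i j : 'I_m => K i j) setT.
Proof.
case/and4P => /eqP sm us /allP s3 /allP HK; apply: indpoly_enum => //.
- exact: disj_sym.
- by move=> i j /s3 i3 /s3 j3; apply: redge_inj.
move=> i j im jm; rewrite redge_disjE ?s3 ?mem_nth ?sm //.
have := HK i; rewrite mem_iota => /(_ im) /allP HKi.
by apply/eqP/HKi; rewrite mem_iota.
Qed.

End NumberedEdges.

(* Both hypergraphs are a path with pendent edges at [v_2] and [v_5]. *)
Lemma indpoly_remove_R (R : comNzRingType) r : (3 <= r)%N ->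
  indpoly R (@disj _) (Redges r 1 1 2 4 :\ redge r 1 1 2 4 9) =
  indpoly R (@disj _) (Redges r 1 3 1 3 :\ redge r 1 3 1 3 10).
Proof.
(* The pendent edge removed is number 9 on the left and 10 on the right. Entry [i] of [s] is the
   left edge corresponding to the right edge [i]. *)
move=> r3; pose s := [:: 0; 1; 2; 3; 4; 5; 6; 7; 8; 10]%N.
pose K i j := redge_disj 1 1 2 4 (nth 0%N s i) (nth 0%N s j).
rewrite (@Redges_remove r 1 1 2 4 r3 9 isT) (@Redges_remove r 1 3 1 3 r3 10 isT).
transitivity (indpoly R (fun i j : 'I_10 => K i j) setT); last symmetry.
  by apply: (indpoly_redge r3); vm_compute.
by apply: (indpoly_redge r3); vm_compute.
Qed.

(* Both sides are the disjoint union of an edge and a triangle with a tail of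
   length three; [s] and [t] list corresponding vertices. *)
Lemma indpoly_avoid_R (R : comNzRingType) r : (3 <= r)%N ->
  indpoly R (@disj _) (avoid (@disj _) (Redges r 1 1 2 4) (redge r 1 1 2 4 9)) =
  indpoly R (@disj _) (avoid (@disj _) (Redges r 1 3 1 3) (redge r 1 3 1 3 10)).
Proof.
move=> r3; pose s := [:: 0; 3; 4; 5; 6; 7; 8; 10]%N; pose t := [:: 6; 0; 1; 2; 3; 9; 7; 8]%N.
pose K i j := redge_disj 1 1 2 4 (nth 0%N s i) (nth 0%N s j).
rewrite (@Redges_avoid r 1 1 2 4 r3 9 isT) (@Redges_avoid r 1 3 1 3 r3 10 isT).
transitivity (indpoly R (fun i j : 'I_8 => K i j) setT); last symmetry.
  by apply: (indpoly_redge r3); vm_compute.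
(* The filter lists the edges increasingly; [t] reorders them to match [s]. *)
have st : perm_eq [seq i <- iota 0 (tlen 1 3 1 3 + 3) | (i != 10) && redge_disj 1 3 1 3 10 i] t.
  by vm_compute.
have -> : [set e in [seq redge r 1 3 1 3 i |
     i <- iota 0 (tlen 1 3 1 3 + 3) & (i != 10) && redge_disj 1 3 1 3 10 i]] =
  [set e in [seq redge r 1 3 1 3 i | i <- t]].
  by apply/setP => e; rewrite [LHS]inE [RHS]inE; apply/perm_mem/perm_map.
by apply: (indpoly_redge r3); vm_compute.
Qed.

(** * Coalescences with a supertree, and the two equalities *)

Section CoalescenceWithR.
Variables (r a b c d : nat) (V : finType) (G : {set {set V}}) (w : V).
Hypotheses (r3 : (3 <= r)%N) (hG : supertree r G).
Variables (u : Rvert r a b c d) (k : 'I_3).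
Local Notation n := (tlen a b c d).
Local Notation E := (coal_edges u w (Redges r a b c d) G).

Lemma spectral_radius_R_coal (R : realType) :
  exists b, [/\ first_root (indpoly R (@disj _) E) b, 0 < spectral_radius R r E &
    spectral_radius R r E ^+ r * b = 1].
Proof.
have [unif conn _] := hG; apply: spectral_radius_hypertree.
- exact: ltnW.
- apply/set0Pn; exists [set inl x | x in pend_edge r a b c d ord0].
  by apply/coal_edgesP; left; exists (pend_edge r a b c d ord0) => //; apply/RedgesP; right; exists ord0.
- exact: coal_uniform (Redges_uniform r3) unif.
- exact: coal_connected (@Redges_connected _ _ _ _ _) conn.
- by apply: coal_branching (@Redges_branching _ _ _ _ _) (supertree_branching _ hG); lia.
Qed.

(** Degree one makes the pendent edge the only edge through [u], as [indpoly_coal] requires. *)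
Lemma indpoly_R_coal (R : comNzRingType) i : (i = n + k)%N ->
  u \in pend_edge r a b c d k -> hdeg (Redges r a b c d) u = 1%N ->
  indpoly R (@disj _) E =
    indpoly R (@disj _) (Redges r a b c d :\ redge r a b c d i) * indpoly R (@disj _) G
    - 'X * (indpoly R (@disj _) (avoid (@disj _) (Redges r a b c d) (redge r a b c d i))
        * indpoly R (@disj _) (hdel G w)).
Proof.
move=> -> uk u1; have -> : redge r a b c d (n + k) = pend_edge r a b c d k.
  by rewrite redge_pend ?leq_addr // addKn inord_val.
have kE : pend_edge r a b c d k \in Redges r a b c d by apply/RedgesP; right; exists k.
have unif := Redges_uniform r3; apply: indpoly_coal => //.
- by apply/negP => /unif; rewrite cards0; lia.
- by rewrite (unif _ _ _ _ _ kE); lia.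
move=> e eE ue; have /eqP/cards1P[f fE] := u1.
have : e \in [set f] by rewrite -fE inE eE.
have : pend_edge r a b c d k \in [set f] by rewrite -fE inE kE.
by rewrite !inE => /eqP -> /eqP ->.
Qed.

End CoalescenceWithR.

(** Comparing coefficients gives equal matching numbers, and equal vertex counts give equal
    exponents, so the matching polynomials coincide. *)
Lemma matching_energy_eq (R : realType) r (V W : finType) (E : {set {set V}})
    (F : {set {set W}}) :
  #|V| = #|W| -> indpoly R (@disj _) E = indpoly R (@disj _) F ->
  matching_energy R r E = matching_energy R r F.
Proof.
move=> VW EF; suff eqp : matching_poly R r E = matching_poly R r F.
  by rewrite /matching_energy /matching_roots eqp.
rewrite /matching_poly VW; apply: eq_bigr => k _; congr ((_ * _%:R) *: _).
have := congr1 (fun p : {poly R} => p`_k) EF; rewrite !coef_indpoly.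
by move=> /(lreg_sign (n := k))/eqP; rewrite eqr_nat => /eqP.
Qed.

Theorem theorem3 (R : realType) (r : nat) (hr : (3 <= r)%N)
  (V : finType) (G : {set {set V}}) (w : V) (hG : supertree r G)
  (u : Rvert r 1 1 2 4)
  (hu : u \in pend_edge r 1 1 2 4 (inord 1))   (* pendent edge at v_3 *)
  (hu1 : hdeg (Redges r 1 1 2 4) u = 1%N)
  (v : Rvert r 1 3 1 3)
  (hv : v \in pend_edge r 1 3 1 3 (inord 2))   (* pendent edge at v_6 *)
  (hv1 : hdeg (Redges r 1 3 1 3) v = 1%N) :
  spectral_radius R r (coal_edges u w (Redges r 1 1 2 4) G)
    = spectral_radius R r (coal_edges v w (Redges r 1 3 1 3) G)
  /\
  matching_energy R r (coal_edges u w (Redges r 1 1 2 4) G)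
    = matching_energy R r (coal_edges v w (Redges r 1 3 1 3) G).
Proof.
have indE : indpoly R (@disj _) (coal_edges u w (Redges r 1 1 2 4) G)
          = indpoly R (@disj _) (coal_edges v w (Redges r 1 3 1 3) G).
  (* Both paths have 8 edges, numbered 0 to 7, so the second and third pendent edges are numbers 9
     and 10. *)
  have i9 : 9 = (tlen 1 1 2 4 + (inord 1 : 'I_3))%N by rewrite inordK.
  have i10 : 10 = (tlen 1 3 1 3 + (inord 2 : 'I_3))%N by rewrite inordK.
  apply: etrans (indpoly_R_coal G w hr R i9 hu hu1) _.
  apply: etrans _ (esym (indpoly_R_coal G w hr R i10 hv hv1)).
  by rewrite (indpoly_remove_R R hr) (indpoly_avoid_R R hr).
split; last first.
  by apply: matching_energy_eq indE; rewrite !card_sum !card_prod !card_ord.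
have [b [bP l0 lb]] := spectral_radius_R_coal w hr hG u R.
have [b' [b'P l'0 l'b']] := spectral_radius_R_coal w hr hG v R.
rewrite indE in bP; have bb' := first_root_uniq bP b'P; have [b0 _ _] := bP.
(* Both radii are positive and have [r]-th power [b^-1] for the common first root [b]. *)
apply/eqP; rewrite -(@eqrXn2 _ r) ?ltW //; last exact: ltn_trans hr.
by apply/eqP/(mulIf (lt0r_neq0 b0)); rewrite lb bb' l'b'.
Qed.
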